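(* Let $(\mathbf Z_n,\mathbf A_{n\times n})$ be generated from the stochastic block model with parameters $(\pi,\rho_nS)$, with $n\rho_n\to\infty$. Then for all $\delta>0$, \[ \sup_{a,b\in[k]}\bigl|\hat P_{ab}(\mathbf A_{n\times n}\mid\mathbf Z_n)-\rho_nS_{ab}\bigr|<\frac{\sqrt{\delta\rho_n\log n}}{n} \] with probability converging to $1$ as $n\to\infty$. Moreover, for all $\alpha>0$ and all $\delta<s_{\min}/2$, if $n\rho_n>\frac{4s_{\max}}{\alpha^2\delta^2}$, then \[ \sup_{a,b\in[k]}\ \sup_{\mathbf e_n\in\mathcal F(n,\alpha)}\bigl|\hat P_{ab}(\mathbf A_{n\times n}\mid\mathbf e_n)-[P_{R(\mathbf e_n,\mathbf Z_n)}]_{ab}\bigr|<\delta\rho_n \] eventually almost surely as $n\to\infty$.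
   Context: SBM with parameters $(\pi,\rho_nS)$: $k\ge2$ fixed; $\pi$ a probability vector on $[k]$ with all $\pi_a>0$; $S$ a fixed symmetric $k\times k$ matrix with strictly positive entries and no two identical columns, $s_{\min},s_{\max}$ its minimal and maximal entries; $\rho_n\to0$; $P=\rho_nS$. $\mathbf Z_n$ i.i.d. with law $\pi$; given $\mathbf Z_n=\mathbf z_n$, $\mathbf A_{n\times n}$ symmetric, zero diagonal, $A_{ij}$ ($i<j$) independent Bernoulli$(P_{z_iz_j})$. For $\mathbf e_n\in[k]^n$: $n_a(\mathbf e_n)=\#\{i:e_i=a\}$; $n_{ab}=n_an_b$ ($a\ne b$), $n_{aa}=n_a(n_a-1)$; $o_{ab}(\mathbf e_n)=\sum_{i,j}\mathbf 1\{e_i=a,e_j=b\}A_{ij}$; $\hat P_{ab}(\mathbf A_{n\times n}\mid\mathbf e_n)=o_{ab}(\mathbf e_n)/n_{ab}(\mathbf e_n)$. $\mathcal F(n,\alpha)=\{\mathbf e_n:n_a(\mathbf e_n)\ge\alpha n\ \forall a\}$. Confusion matrix: $R_{ab}(\mathbf e_n,\mathbf z_n)=\frac1n\sum_i\mathbf 1\{e_i=a,z_i=b\}$. For a nonnegative $k\times k$ matrix $R$, with $\mathbf 1$ the all-ones vector and $\delta_{ab}=\mathbf 1\{a=b\}$: $[P_R]_{ab}=\dfrac{[RPR^T]_{ab}-\delta_{ab}\sum_{i=1}^kP_{ii}R_{ai}/n}{[R\mathbf 1]_a([R\mathbf 1]_b-\delta_{ab}/n)}$; equivalently $n_{ab}(\mathbf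 e_n)[P_{R(\mathbf e_n,\mathbf z_n)}]_{ab}=\mathbb E(o_{ab}(\mathbf e_n)\mid\mathbf Z_n=\mathbf z_n)$. *)

(* Defs.v *)
From HB Require Import structures.
From mathcomp Require Import all_boot all_order all_algebra.
From mathcomp Require Import all_classical all_reals all_analysis.
Set Implicit Arguments. Unset Strict Implicit. Unset Printing Implicit Defensive.
Import Order.TTheory GRing.Theory Num.Theory.
Local Open Scope classical_set_scope.
Local Open Scope ring_scope.

Definition labeling (k n : nat) := {ffun 'I_n -> 'I_k}.
Definition adjmat (n : nat) := {ffun 'I_n * 'I_n -> bool}.
Definition config (k n : nat) := (labeling k n * adjmat n)%type.

Definition n_lab (k n : nat) (e : labeling k n) (a : 'I_k) : nat :=
  #|[set i | e i == a]|.

Definition n_pair (R : realType) (k n : nat) (e : labeling k n) (a b : 'I_k) : R :=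
  if a == b then (n_lab e a)%:R * ((n_lab e a)%:R - 1)
  else (n_lab e a)%:R * (n_lab e b)%:R.

Definition o_pair (R : realType) (k n : nat) (A : adjmat n) (e : labeling k n)
  (a b : 'I_k) : R :=
  \sum_(i : 'I_n) \sum_(j : 'I_n) ((e i == a) && (e j == b) && A (i, j))%:R.

Definition hatP (R : realType) (k n : nat) (A : adjmat n) (e : labeling k n)
  (a b : 'I_k) : R := o_pair R A e a b / n_pair R e a b.

Definition confusion (R : realType) (k n : nat) (e z : labeling k n)
  (a b : 'I_k) : R :=
  (#|[set i | (e i == a) && (z i == b)]|)%:R / n%:R.

Definition P_R (R : realType) (k n : nat) (P Rm : 'I_k -> 'I_k -> R)
  (a b : 'I_k) : R :=
  (\sum_(i : 'I_k) \sum_(j : 'I_k) Rm a i * P i j * Rm b j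
     - (a == b)%:R * (\sum_(i : 'I_k) P i i * Rm a i) / n%:R)
  / ((\sum_(i : 'I_k) Rm a i) * (\sum_(i : 'I_k) Rm b i - (a == b)%:R / n%:R)).

Definition in_F (R : realType) (k n : nat) (alpha : R) (e : labeling k n) : Prop :=
  forall a : 'I_k, alpha * n%:R <= (n_lab e a)%:R.

(* s_max, s_min of S (for S with positive entries, k >= 1) *)
Definition smax (R : realType) (k : nat) (S : 'I_k -> 'I_k -> R) : R :=
  \big[Num.max/0]_(a : 'I_k) \big[Num.max/0]_(b : 'I_k) S a b.
Definition smin (R : realType) (k : nat) (S : 'I_k -> 'I_k -> R) : R :=
  \big[Num.min/smax S]_(a : 'I_k) \big[Num.min/smax S]_(b : 'I_k) S a b.

Definition sym_zero_diag (n : nat) (A : adjmat n) : bool :=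
  [forall i, forall j, A (i, j) == A (j, i)] && [forall i, ~~ A (i, i)].

Definition sbm_prob (R : realType) (k n : nat) (pi : 'I_k -> R)
  (P : 'I_k -> 'I_k -> R) (c : config k n) : R :=
  let z := c.1 in let A := c.2 in
  (\prod_(i : 'I_n) pi (z i)) *
  (if sym_zero_diag A then
     \prod_(i : 'I_n) \prod_(j : 'I_n | (i < j)%N)
        (if A (i, j) then P (z i) (z j) else 1 - P (z i) (z j))
   else 0).

Definition is_sbm (R : realType) (d : measure_display) (T : measurableType d)
  (Pr : probability T R) (k : nat) (pi : 'I_k -> R) (rho : nat -> R)
  (S : 'I_k -> 'I_k -> R) (X : forall n, T -> config k n) : Prop :=
  forall n (c : config k n),
    measurable (X n @^-1` [set c]) /\
    Pr (X n @^-1` [set c]) = (sbm_prob pi (fun a b => rho n * S a b) c)%:E.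

(* Main.v *)
(* Given the labels Z = z, the count o_ab(e) is a sum over unordered pairs of
   independent Bernoulli variables with weights in {0, 1, 2}, hence its centred
   moment generating function at l is at most exp(8 l^2 M rho n^2) for
   |l| <= 1/4, where M bounds S.  Chernoff's inequality with l = 1/(n sqrt rho)
   gives the first claim: the deviation sqrt(delta rho log n)/n of P_ab has
   probability O(exp(-C sqrt(log n))), once all classes of Z have linear size,
   which fails with exponentially small probability.  With l a small constant
   the probability of a deviation delta rho is exp(-C rho n^2), which beats the
   k^n labelings e because n rho tends to infinity; Borel-Cantelli concludes. *)

Require Import Defs.
From HB Require Import structures.
From mathcomp Require Import all_boot all_order all_algebra.
From mathcomp Require Import all_classical all_reals all_analysis.
From mathcomp Require Import ring lra.
Set Implicit Arguments. Unset Strict Implicit. Unset Printing Implicit Defensive.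
Import Order.TTheory GRing.Theory Num.Theory.
Local Open Scope classical_set_scope.
Local Open Scope ring_scope.

(** * Symmetric adjacency matrices and unordered pairs *)

Definition upper (n : nat) (p : 'I_n * 'I_n) : bool := (p.1 < p.2)%N.

(** Such a matrix is determined by its entries above the diagonal, which are free, so the sum of
    products factorises: this is the independence of the edges. *)
Lemma sum_sym_zero_diag (R : comNzRingType) (n : nat)
  (F : 'I_n * 'I_n -> bool -> R) :
  \sum_(A : adjmat n | sym_zero_diag A) \prod_(p | upper p) F p (A p) =
  \prod_(p | upper p) (F p true + F p false).
Proof.
under [RHS]eq_bigr => p _.
  rewrite (_ : F p true + F p false = \sum_(b : bool | predT b) F p b); last first.
    by rewrite big_bool.
  over.
rewrite (big_distr_big_dep false).
(* Distributing leaves matrices that are [false] off the upper pairs; [sy] adds the mirror image to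
   such a matrix, and [up] cuts it off again. *)
pose sy (f : adjmat n) : adjmat n := [ffun p => f p || f (p.2, p.1)].
pose up (A : adjmat n) : adjmat n := [ffun p => upper p && A p].
rewrite (reindex_onto sy up); last first.
  move=> A /andP[/'forall_forallP symA /forallP dA].
  apply/ffunP => -[i j]; rewrite !ffunE /upper /=.
  rewrite (eqP (symA j i)) -andb_orl.
  case: (ltngtP i j) => [//|//|/val_inj ->]; by rewrite (negPf (dA j)).
apply: eq_big => [f|f].
- apply/idP/pfamilyP.
    move=> /andP[_ /eqP fE]; split=> [|//].
    apply/fintype.subsetP => p.
    by rewrite inE -fE ffunE -[p \in _]/(upper p); case: (upper p).
  move=> [/fintype.subsetP sf _]; have {}sf p : f p -> upper p.
    by move=> fp; apply: sf; rewrite inE; apply/eqP; rewrite fp.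
  apply/andP; split; [apply/andP; split|].
  + by apply/'forall_forallP => i j; rewrite !ffunE /= orbC.
  + by apply/forallP => i; rewrite ffunE /= orbb; apply/negP => /sf; rewrite /upper ltnn.
  + apply/eqP/ffunP => -[i j]; rewrite !ffunE /=.
    apply/idP/idP.
      case/andP => ij /orP[//|/sf]; rewrite /upper /= => ji.
      by move: (ltn_trans ij ji); rewrite ltnn.
    by move=> fij; rewrite fij sf.
- move=> /andP[/andP[_ _] /eqP fE]; apply: eq_bigr => p up_p.
  congr F; rewrite -fE !ffunE up_p /=.
  suff -> : upper (p.2, p.1) = false by rewrite /= orbF; case: p up_p.
  by rewrite /upper /=; apply/negbTE; rewrite -leqNgt ltnW.
Qed.

Lemma sum_sym_pairs (R : nmodType) (n : nat) (F : 'I_n -> 'I_n -> R) :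
  \sum_(i : 'I_n) \sum_(j : 'I_n) F i j =
  \sum_(p | upper p) (F p.1 p.2 + F p.2 p.1) + \sum_(i : 'I_n) F i i.
Proof.
rewrite pair_big /= (bigID (@upper n)) /= big_split /= -addrA; congr (_ + _).
rewrite (bigID (fun p : 'I_n * 'I_n => p.1 == p.2)) /= addrC; congr (_ + _).
- rewrite (reindex_inj (h := fun p : 'I_n * 'I_n => (p.2, p.1))) /=; last first.
    by case=> i j [k l] [-> ->].
  apply: eq_bigl => -[i j]; rewrite /upper /= -leqNgt -val_eqE /=.
  by rewrite ltn_neqAle andbC eq_sym.
- rewrite (reindex_onto (fun i : 'I_n => (i, i)) fst) /=; last first.
    by case=> i j /andP[_ /eqP /= ->].
  by apply: eq_bigl => i; rewrite /upper /= ltnn !eqxx.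
Qed.

(* The number of ordered edges from class [a] to class [b] carried by the
   unordered pair [p]; it is [2] when [a = b] and both endpoints lie in [a]. *)
Definition weight (R : realType) (k n : nat) (e : labeling k n) (a b : 'I_k)
  (p : 'I_n * 'I_n) : R :=
  ((e p.1 == a) && (e p.2 == b))%:R + ((e p.2 == a) && (e p.1 == b))%:R.

(** The conditional expectation of [o_pair] for the labeling [e], given that the true labels are
    [z]. *)
Definition mean_pair (R : realType) (k n : nat) (P : 'I_k -> 'I_k -> R)
  (e z : labeling k n) (a b : 'I_k) : R :=
  \sum_(p | upper p) weight R e a b p * P (z p.1) (z p.2).

Lemma weight_ge0 (R : realType) (k n : nat) (e : labeling k n) a b p :
  0 <= weight R e a b p.
Proof. by rewrite addr_ge0 ?ler0n. Qed.

Lemma weight_le2 (R : realType) (k n : nat) (e : labeling k n) a b p :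
  weight R e a b p <= 2.
Proof. by rewrite /weight; do 2 case: (_ && _) => /=; lra. Qed.

Lemma o_pair_weight (R : realType) (k n : nat) (A : adjmat n)
  (e : labeling k n) (a b : 'I_k) : sym_zero_diag A ->
  o_pair R A e a b = \sum_(p | upper p) weight R e a b p * (A p)%:R.
Proof.
move=> /andP[/'forall_forallP symA /forallP dA].
rewrite /o_pair sum_sym_pairs [X in _ + X]big1 ?addr0; last first.
  by move=> i _; rewrite (negPf (dA i)) andbF.
apply: eq_bigr => -[i j] _ /=.
by rewrite (eqP (symA j i)) mulrDl /= -!natrM !mulnb.
Qed.

Lemma mem_setb (T : Type) (P : pred T) (x : T) : (x \in [set y | P y]) = P x.
Proof. by apply/idP/idP => [/set_mem|/mem_set]. Qed.

Lemma n_lab_sum (R : realType) (k n : nat) (e : labeling k n) (a : 'I_k) :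
  (n_lab e a)%:R = \sum_(i : 'I_n) (e i == a)%:R :> R.
Proof.
rewrite /n_lab -sum1_card natr_sum big_mkcond /=.
by apply: eq_bigr => i _; rewrite mem_setb; case: eqP.
Qed.

(** Expanding both class sizes into indicators gives ordered pairs of vertices; the terms with equal
    vertices sum to [n_lab e a] if [a = b] and vanish otherwise, whence the [- 1] in [n_pair]. *)
Lemma n_pair_weight (R : realType) (k n : nat) (e : labeling k n) (a b : 'I_k) :
  n_pair R e a b = \sum_(p | upper p) weight R e a b p.
Proof.
have E : (n_lab e a)%:R * (n_lab e b)%:R =
    \sum_(p | upper p) weight R e a b p + \sum_i ((e i == a) && (e i == b))%:R :> R.
  rewrite !n_lab_sum mulr_suml; under eq_bigr do rewrite mulr_sumr.
  rewrite sum_sym_pairs; congr (_ + _); apply: eq_bigr => i _.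
    by rewrite -!natrM !mulnb.
  by rewrite -natrM mulnb.
rewrite /n_pair; case: eqP E => [<-|/eqP ab] E.
  rewrite mulrBr mulr1 E; under [X in _ + X - _]eq_bigr do rewrite andbb.
  by rewrite -n_lab_sum addrK.
rewrite E [X in _ + X]big1 ?addr0 // => i _; case: eqP => //= ->.
by rewrite (negPf ab).
Qed.

(** A pair of nonzero weight joins the classes [a] and [b] of [z] itself, so its edge probability is
    [P a b]; hence [hatP] at the true labels is centred at [P a b]. *)
Lemma mean_pair_diag (R : realType) (k n : nat) (P : 'I_k -> 'I_k -> R)
  (z : labeling k n) (a b : 'I_k) : (forall a b, P a b = P b a) ->
  mean_pair P z z a b = P a b * n_pair R z a b.
Proof.
move=> symP; rewrite n_pair_weight mulr_sumr; apply: eq_bigr => p _.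
rewrite /weight mulrDl mulrDr; congr (_ + _); last rewrite (symP (z p.1)).
- by case: (z p.1 =P a) => [->|_]; case: (z p.2 =P b) => [->|_];
    rewrite /= ?mulr1 ?mul1r ?mul0r ?mulr0.
- by case: (z p.2 =P a) => [->|_]; case: (z p.1 =P b) => [->|_];
    rewrite /= ?mulr1 ?mul1r ?mul0r ?mulr0.
Qed.

(** * The matrix [P_R] as a normalised conditional mean *)

Lemma confusion_sum (R : realType) (k n : nat) (e z : labeling k n) (a b : 'I_k) :
  confusion R e z a b = (\sum_(i : 'I_n) (e i == a)%:R * (z i == b)%:R) / n%:R.
Proof.
rewrite /confusion -sum1_card natr_sum big_mkcond /=; congr (_ / _).
by apply: eq_bigr => i _; rewrite mem_setb -natrM mulnb; case: (_ && _).
Qed.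

Lemma sum_label (R : pzSemiRingType) (k : nat) (c : 'I_k) (F : 'I_k -> R) :
  \sum_(b : 'I_k) (c == b)%:R * F b = F c.
Proof.
rewrite (bigD1 c) //= eqxx mul1r big1 ?addr0 // => b bc.
by rewrite eq_sym (negPf bc) mul0r.
Qed.

(** The factors [n ^ 2] cancel, leaving sums over pairs of vertices; the corrections at [a = b]
    remove the loops, which a zero-diagonal matrix never has. *)
Lemma P_R_mean (R : realType) (k n : nat) (P : 'I_k -> 'I_k -> R)
  (e z : labeling k n) (a b : 'I_k) : (0 < n)%N -> (forall a b, P a b = P b a) ->
  P_R n P (confusion R e z) a b = mean_pair P e z a b / n_pair R e a b.
Proof.
move=> n0 symP; have n0R : (n%:R : R) != 0 by rewrite pnatr_eq0 -lt0n.
have row c : \sum_i confusion R e z c i = (n_lab e c)%:R / n%:R.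
  under eq_bigr do rewrite confusion_sum.
  rewrite -mulr_suml n_lab_sum exchange_big /=; congr (_ / _).
  apply: eq_bigr => i _; rewrite -mulr_sumr.
  under eq_bigr do rewrite -[_%:R]mulr1.
  by rewrite sum_label mulr1.
(* Expanding the confusion entries over vertices gives a sum over ordered pairs; the second summand
   collects the loops. *)
have quad : \sum_i \sum_j confusion R e z a i * P i j * confusion R e z b j =
    (mean_pair P e z a b +
     \sum_i ((e i == a) && (e i == b))%:R * P (z i) (z i)) / n%:R ^+ 2.
  transitivity ((\sum_i \sum_j ((e i == a) && (e j == b))%:R * P (z i) (z j))
      / (n%:R ^+ 2 : R)); last first.
    rewrite sum_sym_pairs; congr ((_ + _) / _); apply: eq_bigr => p _.
    by rewrite mulrDl (symP (z p.2)).
  transitivity (\sum_c \sum_d ((\sum_i (e i == a)%:R * (z i == c)%:R) * P c d *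
      (\sum_j (e j == b)%:R * (z j == d)%:R)) / (n%:R ^+ 2 : R)).
    apply: eq_bigr => c _; apply: eq_bigr => d' _.
    by rewrite !confusion_sum; field.
  under eq_bigr do rewrite -mulr_suml.
  rewrite -mulr_suml; congr (_ / _).
  under eq_bigr => c _ do under eq_bigr => d' _ do
    rewrite -mulrA mulr_suml.
  under eq_bigr => c _ do rewrite exchange_big /=.
  rewrite exchange_big /=; apply: eq_bigr => i _.
  under eq_bigr => c _.
    under eq_bigr => d' _ do rewrite mulrA mulr_sumr.
    rewrite exchange_big /=; over.
  rewrite exchange_big /=; apply: eq_bigr => j _.
  under eq_bigr => c _.
    rewrite (_ : \sum_i0 _ = (z i == c)%:R *
      ((e i == a)%:R * (e j == b)%:R * P c (z j))); last first.
      under eq_bigr => d' _.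
        rewrite (_ : _ * _ = (z j == d')%:R *
          ((z i == c)%:R * ((e i == a)%:R * (e j == b)%:R * P c d'))); last by ring.
        over.
      by rewrite (sum_label (z j) (fun d' => (z i == c)%:R *
          ((e i == a)%:R * (e j == b)%:R * P c d'))).
    over.
  rewrite (sum_label (z i) (fun c => (e i == a)%:R * (e j == b)%:R * P c (z j))).
  by rewrite -natrM mulnb.
have diag : \sum_i P i i * confusion R e z a i =
    (\sum_i (e i == a)%:R * P (z i) (z i)) / n%:R.
  under eq_bigr do rewrite confusion_sum mulrA mulr_sumr.
  rewrite -mulr_suml exchange_big /=; congr (_ / _); apply: eq_bigr => i _.
  under eq_bigr => c _.
    rewrite (_ : _ * _ = (z i == c)%:R * ((e i == a)%:R * P c c)); last by ring.
    over.
  by rewrite (sum_label (z i) (fun c => (e i == a)%:R * P c c)).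
have frac (x y : R) : x / n%:R ^+ 2 / (y / n%:R ^+ 2) = x / y.
  by rewrite invf_div mulrA divfK // expf_neq0.
rewrite /P_R !row quad diag /n_pair; case: eqP => [<-|/eqP ab].
  rewrite (eq_bigr (fun i => (e i == a)%:R * P (z i) (z i))); last first.
    by move=> i _; rewrite andbb.
  set D := \sum_i _; set m := mean_pair _ _ _ _ _; rewrite !mul1r.
  rewrite (_ : (m + D) / n%:R ^+ 2 - D / n%:R / n%:R = m / n%:R ^+ 2); last by field.
  rewrite (_ : (n_lab e a)%:R / n%:R * ((n_lab e a)%:R / n%:R - n%:R^-1) =
    (n_lab e a)%:R * ((n_lab e a)%:R - 1) / (n%:R ^+ 2 : R)); last by field.
  by rewrite frac.
(* For [a != b] no vertex carries both labels, so there are no loops to remove. *)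
rewrite big1 ?addr0; last first.
  by move=> i _; case: eqP => [->|_]; rewrite ?(negPf ab) ?mul0r.
rewrite !mul0r !subr0.
rewrite (_ : (n_lab e a)%:R / n%:R * ((n_lab e b)%:R / n%:R) =
  (n_lab e a)%:R * (n_lab e b)%:R / (n%:R ^+ 2 : R)); last by field.
by rewrite frac.
Qed.

(** * Exponential moments of the edge counts given the labels *)

(* From [expR (- x) >= 1 - x]; the constant 2 (rather than 1) is what makes
   [(1 - x) * (1 + x + 2 * x ^+ 2) >= 1] for all [x <= 1/2]. *)
Lemma expR_le_quadratic (R : realType) (x : R) :
  x <= 2^-1 -> expR x <= 1 + x + 2 * x ^+ 2.
Proof.
move=> x2; have := expR_ge1Dx (- x); rewrite expRN => xV.
have x1 : 0 < 1 - x by lra.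
have : expR x <= (1 - x)^-1.
  by rewrite -[expR x]invrK lef_pV2 ?posrE ?invr_gt0 ?expR_gt0.
move/le_trans; apply.
rewrite -div1r ler_pdivrMr //.
have : 0 <= x ^+ 2 * (1 - 2 * x) by rewrite mulr_ge0 ?sqr_ge0 //; lra.
by nra.
Qed.

(** The left side is [1 + p * (expR x - 1)]; bound [expR x] quadratically and use
    [1 + y <= expR y]. *)
Lemma bernoulli_mgf (R : realType) (p x : R) : 0 <= p -> x <= 2^-1 ->
  p * expR x + (1 - p) <= expR (p * x + 2 * p * x ^+ 2).
Proof.
move=> p0 x2; apply: le_trans (expR_ge1Dx _).
have := ler_wpM2l p0 (expR_le_quadratic x2); nra.
Qed.

Definition edge_prob (R : realType) (k n : nat) (P : 'I_k -> 'I_k -> R)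
  (z : labeling k n) (A : adjmat n) : R :=
  \prod_(p | upper p)
    (if A p then P (z p.1) (z p.2) else 1 - P (z p.1) (z p.2)).

Definition label_prob (R : realType) (k n : nat) (pi : 'I_k -> R)
  (z : labeling k n) : R := \prod_(i : 'I_n) pi (z i).

Lemma sum_edge_prob (R : realType) (k n : nat) (P : 'I_k -> 'I_k -> R)
  (z : labeling k n) : \sum_(A | sym_zero_diag A) edge_prob P z A = 1.
Proof.
rewrite (sum_sym_zero_diag (fun p (t : bool) =>
  if t then P (z p.1) (z p.2) else 1 - P (z p.1) (z p.2))).
by apply: big1 => p _; rewrite addrC subrK.
Qed.

(** By independence the sum is a product of Bernoulli factors; centring cancels the linear terms,
    and since weights are at most 2, each pair leaves at most [2 * pm * (2 * l) ^+ 2]. *)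
Lemma edge_mgf (R : realType) (k n : nat) (P : 'I_k -> 'I_k -> R) (pm l : R)
  (e z : labeling k n) (a b : 'I_k) :
  (forall a b, 0 <= P a b <= 1) -> (forall a b, P a b <= pm) -> `|l| <= 4^-1 ->
  \sum_(A | sym_zero_diag A)
     expR (l * (o_pair R A e a b - mean_pair P e z a b)) * edge_prob P z A
  <= expR (8 * l ^+ 2 * pm * n%:R ^+ 2).
Proof.
move=> P01 Ppm l4; set m := mean_pair _ _ _ _ _.
pose x p := l * weight R e a b p; pose q p := P (z p.1) (z p.2).
pose F p (t : bool) : R := if t then q p * expR (x p) else 1 - q p.
rewrite (eq_bigr (fun A : adjmat n => expR (- (l * m)) * \prod_(p | upper p) F p (A p)));
    last first.
  move=> A symA; rewrite o_pair_weight // mulrBr expRD mulrC mulrA mulrC.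
  congr (_ * _); rewrite mulr_sumr expR_sum -big_split /=.
  apply: eq_bigr => p _; rewrite /F /x; case: (A p).
    by rewrite mulr1.
  by rewrite mulr0 mulr0 expR0 mulr1.
rewrite -mulr_sumr sum_sym_zero_diag.
have q0 p : 0 <= q p by case/andP: (P01 (z p.1) (z p.2)).
have q1 p : q p <= 1 by case/andP: (P01 (z p.1) (z p.2)).
have step : \prod_(p | upper p) (F p true + F p false) <=
    expR (\sum_(p | upper p) (q p * x p + 2 * q p * x p ^+ 2)).
  rewrite expR_sum; apply: ler_prod => p _; rewrite /F; apply/andP; split.
    by rewrite addr_ge0 ?mulr_ge0 ?expR_ge0 ?subr_ge0.
  (* A weight at most 2 and [|l| <= 1/4] keep [x p <= 1/2], the range of the quadratic bound. *)
  apply: bernoulli_mgf => //; apply: le_trans (ler_norm _) _.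
  rewrite /x normrM (ger0_norm (weight_ge0 _ _ _ _ _)).
  by have := ler_pM (normr_ge0 l) (weight_ge0 R e a b p) l4 (weight_le2 R e a b p); lra.
apply: (le_trans (ler_wpM2l (expR_ge0 _) step)).
rewrite -expRD ler_expR big_split /= addrA.
rewrite (_ : - (l * m) + \sum_(p | upper p) q p * x p = 0); last first.
  rewrite /m /mean_pair mulr_sumr -sumrN -big_split /= big1 // => p _.
  by rewrite /x /q; ring.
rewrite add0r.
have pm0 : 0 <= pm by apply: le_trans (Ppm a b); case/andP: (P01 a b).
have -> : 8 * l ^+ 2 * pm * n%:R ^+ 2 =
    \sum_(p : 'I_n * 'I_n) 8 * l ^+ 2 * pm.
  by rewrite sumr_const card_prod !card_ord -[RHS]mulr_natr natrM.
rewrite big_mkcond /=; apply: ler_sum => p _; case: ifP => _; last first.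
  by rewrite mulr_ge0 // mulr_ge0 // sqr_ge0.
have w2 : weight R e a b p ^+ 2 <= 4.
  by have := weight_ge0 R e a b p; have := weight_le2 R e a b p; nra.
have : q p * weight R e a b p ^+ 2 <= pm * 4.
  by apply: ler_pM => //; rewrite ?sqr_ge0 //; exact: Ppm.
rewrite /x exprMn => /(ler_wpM2l (sqr_ge0 l)); lra.
Qed.

(** * Expectations under the block model *)

(** Expectation under the law [sbm_prob], kept as a finite sum; [is_sbm_event_le] transfers it to
    [Pr]. *)
Definition Esbm (R : realType) (k n : nat) (pi : 'I_k -> R)
  (P : 'I_k -> 'I_k -> R) (f : config k n -> R) : R :=
  \sum_(c : config k n) f c * sbm_prob pi P c.

Lemma sbm_prob_edge (R : realType) (k n : nat) (pi : 'I_k -> R)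
  (P : 'I_k -> 'I_k -> R) (c : config k n) :
  sbm_prob pi P c =
  label_prob pi c.1 * (if sym_zero_diag c.2 then edge_prob P c.1 c.2 else 0).
Proof.
rewrite /sbm_prob /=; congr (_ * _); case: ifP => // _.
by rewrite pair_big_dep /=; apply: eq_bigr => -[i j].
Qed.

Lemma Esbm_cond (R : realType) (k n : nat) (pi : 'I_k -> R)
  (P : 'I_k -> 'I_k -> R) (f : config k n -> R) :
  Esbm pi P f = \sum_z label_prob pi z *
    \sum_(A | sym_zero_diag A) f (z, A) * edge_prob P z A.
Proof.
under [RHS]eq_bigr do rewrite mulr_sumr big_mkcond.
rewrite pair_big /=; apply: eq_bigr => -[z A] _; rewrite sbm_prob_edge /=.
by case: ifP => _; [rewrite mulrCA | rewrite !mulr0].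
Qed.

Lemma sum_label_prod (R : realType) (k n : nat) (F : 'I_k -> R) :
  \sum_(z : labeling k n) \prod_(i : 'I_n) F (z i) = (\sum_a F a) ^+ n.
Proof.
by rewrite -(bigA_distr_bigA (fun _ a => F a)) prodr_const card_ord.
Qed.

Lemma sbm_prob_ge0 (R : realType) (k n : nat) (pi : 'I_k -> R)
  (P : 'I_k -> 'I_k -> R) (c : config k n) :
  (forall a, 0 <= pi a) -> (forall a b, 0 <= P a b <= 1) -> 0 <= sbm_prob pi P c.
Proof.
move=> pi0 P01; rewrite sbm_prob_edge mulr_ge0 ?prodr_ge0 //.
case: ifP => // _; apply: prodr_ge0 => p _.
by case: (c.2 p); case/andP: (P01 (c.1 p.1) (c.1 p.2)); rewrite ?subr_ge0.
Qed.

Lemma Esbm_sum (R : realType) (k n : nat) (pi : 'I_k -> R)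
  (P : 'I_k -> 'I_k -> R) (I : finType) (f : I -> config k n -> R) :
  Esbm pi P (fun c => \sum_i f i c) = \sum_i Esbm pi P (f i).
Proof.
rewrite /Esbm exchange_big /=; apply: eq_bigr => c _.
by rewrite mulr_suml.
Qed.

Lemma EsbmD (R : realType) (k n : nat) (pi : 'I_k -> R)
  (P : 'I_k -> 'I_k -> R) (f g : config k n -> R) :
  Esbm pi P (fun c => f c + g c) = Esbm pi P f + Esbm pi P g.
Proof. by rewrite /Esbm -big_split /=; apply: eq_bigr => c _; rewrite mulrDl. Qed.

Lemma EsbmMr (R : realType) (k n : nat) (pi : 'I_k -> R)
  (P : 'I_k -> 'I_k -> R) (f : config k n -> R) (x : R) :
  Esbm pi P (fun c => f c * x) = Esbm pi P f * x.
Proof. by rewrite /Esbm mulr_suml; apply: eq_bigr => c _; rewrite mulrAC. Qed.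

(** The labeling [e] may depend on the true labels because the edge bound is conditional on them:
    [id] serves the first claim, constant functions the second. *)
Lemma Esbm_mgf (R : realType) (k n : nat) (pi : 'I_k -> R)
  (P : 'I_k -> 'I_k -> R) (pm l : R) (e : labeling k n -> labeling k n)
  (a b : 'I_k) :
  (forall a, 0 <= pi a) -> \sum_a pi a = 1 ->
  (forall a b, 0 <= P a b <= 1) -> (forall a b, P a b <= pm) -> `|l| <= 4^-1 ->
  Esbm pi P (fun c => expR (l * (o_pair R c.2 (e c.1) a b
                                 - mean_pair P (e c.1) c.1 a b)))
  <= expR (8 * l ^+ 2 * pm * n%:R ^+ 2).
Proof.
move=> pi0 pi1 P01 Ppm l4; rewrite Esbm_cond /=.
apply: (@le_trans _ _ (\sum_z label_prob pi z * expR (8 * l ^+ 2 * pm * n%:R ^+ 2))).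
  apply: ler_sum => z _; apply: ler_wpM2l; first exact: prodr_ge0.
  exact: edge_mgf.
by rewrite -mulr_suml sum_label_prod pi1 expr1n mul1r.
Qed.

(** Labels are independent, so the Laplace transform of a class size is an [n]-th power; the margin
    [x <= pi a / 4] leaves decay after the factor [expR (x * n)]. *)
Lemma Esbm_class_size (R : realType) (k n : nat) (pi : 'I_k -> R)
  (P : 'I_k -> 'I_k -> R) (x : R) (a : 'I_k) :
  (forall a, 0 <= pi a) -> \sum_a pi a = 1 -> x <= pi a / 4 ->
  Esbm pi P (fun c : config k n => expR (x * n%:R - (n_lab c.1 a)%:R)) <= expR (- (x * n%:R)).
Proof.
move=> pi0 pi1 xa; rewrite Esbm_cond /=.
under eq_bigr do rewrite -mulr_sumr sum_edge_prob mulr1.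
pose F b := pi b * expR (- (b == a)%:R).
rewrite (eq_bigr (fun z : labeling k n => (\prod_i F (z i)) * expR (x * n%:R))); last first.
  move=> z _; rewrite expRD mulrCA mulrC; congr (_ * _).
  by rewrite n_lab_sum -sumrN expR_sum /label_prob -big_split.
rewrite -mulr_suml sum_label_prod.
(* Since [expR (- 1) <= 1/2], the sum is at most [1 - pi a / 2], hence at most [1 - 2 * x]. *)
have F1 : \sum_b F b <= expR (- (2 * x)).
  rewrite (bigD1 a) //= /F eqxx.
  rewrite (eq_bigr pi); last by move=> b /negPf ->; rewrite oppr0 expR0 mulr1.
  move: pi1; rewrite (bigD1 a) //= => pi1.
  apply: le_trans (expR_ge1Dx _).
  have e2 : expR (- 1) <= 2^-1 :> R.
    rewrite expRN lef_pV2 ?posrE ?expR_gt0 ?ltr0n //.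
    by apply: le_trans (expR_ge1Dx 1); lra.
  have := ler_wpM2l (pi0 a) e2; lra.
have F0 : 0 <= \sum_b F b by apply: sumr_ge0 => b _; rewrite mulr_ge0 ?expR_ge0.
apply: (@le_trans _ _ (expR (- (2 * x)) ^+ n * expR (x * n%:R))).
  by apply: ler_wpM2r; rewrite ?expR_ge0 // lerXn2r ?nnegrE ?expR_ge0.
rewrite -expRM_natl -expRD ler_expR; lra.
Qed.

(** * Chernoff bounds and the passage to probabilities *)

(** For [l >= 0], a two-sided exponential majorant of the indicator of [t <= |x|]. *)
Definition chernoff_weight (R : realType) (l t x : R) : R :=
  (expR (l * x) + expR (- l * x)) * expR (- (l * t)).

Lemma chernoff_weight_ge0 (R : realType) (l t x : R) : 0 <= chernoff_weight l t x.
Proof. by rewrite mulr_ge0 ?addr_ge0 ?expR_ge0. Qed.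

Lemma chernoff_weight_ge1 (R : realType) (l t x : R) :
  0 <= l -> t <= `|x| -> 1 <= chernoff_weight l t x.
Proof.
move=> l0 tx; rewrite /chernoff_weight mulrDl -!expRD.
have key s : t <= s -> 1 <= expR (l * s + - (l * t)).
  by move=> ts; rewrite -expR0 ler_expR -mulrBr mulr_ge0 // subr_ge0.
case: (lerP 0 x) tx => x0.
  by rewrite ?ger0_norm // => /key H; rewrite ler_wpDr ?expR_ge0.
by rewrite ltr0_norm // => /key; rewrite mulrN -mulNr => H; rewrite ler_wpDl ?expR_ge0.
Qed.

Lemma Esbm_chernoff (R : realType) (k n : nat) (pi : 'I_k -> R)
  (P : 'I_k -> 'I_k -> R) (pm l t : R) (e : labeling k n -> labeling k n)
  (a b : 'I_k) :
  (forall a, 0 <= pi a) -> \sum_a pi a = 1 ->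
  (forall a b, 0 <= P a b <= 1) -> (forall a b, P a b <= pm) -> 0 <= l <= 4^-1 ->
  Esbm pi P (fun c => chernoff_weight l t (o_pair R c.2 (e c.1) a b
                                    - mean_pair P (e c.1) c.1 a b))
  <= 2 * expR (8 * l ^+ 2 * pm * n%:R ^+ 2 - l * t).
Proof.
move=> pi0 pi1 P01 Ppm /andP[l0 l4]; rewrite /chernoff_weight EsbmMr EsbmD.
rewrite expRD mulrA; apply: ler_wpM2r; first exact: expR_ge0.
rewrite mulr_natl mulr2n; apply: lerD; first by apply: Esbm_mgf; rewrite ?ger0_norm.
by rewrite -[l ^+ 2]sqrrN; apply: Esbm_mgf; rewrite ?normrN ?ger0_norm.
Qed.

(** There are finitely many configurations, so the preimage is a finite union of measurable fibres,
    and subadditivity gives the bound. *)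
Lemma is_sbm_event (R : realType) (d : measure_display) (T : measurableType d)
  (Pr : probability T R) (k : nat) (pi : 'I_k -> R) (rho : nat -> R)
  (S : 'I_k -> 'I_k -> R) (X : forall n, T -> config k n) (n : nat)
  (Q : set (config k n)) : is_sbm Pr pi rho S X ->
  measurable (X n @^-1` Q) /\
  (Pr (X n @^-1` Q) <=
    (\sum_(c | c \in Q) sbm_prob pi (fun a b => (rho n * S a b)%R) c)%:E)%E.
Proof.
move=> sbm.
have -> : X n @^-1` Q = \big[setU/set0]_(c | c \in Q) X n @^-1` [set c].
  apply/seteqP; split => [w Qw|w].
    by rewrite (bigD1 (X n w)) /=; [left | exact: mem_set].
  elim/big_ind: _ => [//|A B IA IB [/IA|/IB]//|c cQ /= ->]; exact: set_mem.
rewrite -sumEFin; elim/big_ind2: _ => [|A x B y [mA Ax] [mB By]|c cQ].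
- by rewrite measure0; split => //; exact: measurable0.
- split; first exact: measurableU.
  by apply: (le_trans (measureU2 _ mA mB)); exact: leeD.
- by have [? ->] := sbm n c.
Qed.

(** Markov's inequality in the form of an [f] that dominates the indicator of [Q]. *)
Lemma is_sbm_event_le (R : realType) (d : measure_display) (T : measurableType d)
  (Pr : probability T R) (k : nat) (pi : 'I_k -> R) (rho : nat -> R)
  (S : 'I_k -> 'I_k -> R) (X : forall n, T -> config k n) (n : nat)
  (Q : set (config k n)) (f : config k n -> R) : is_sbm Pr pi rho S X ->
  (forall a, 0 <= pi a) -> (forall a b, 0 <= rho n * S a b <= 1) ->
  (forall c, 0 <= f c) -> (forall c, Q c -> 1 <= f c) ->
  (Pr (X n @^-1` Q) <= (Esbm pi (fun a b => (rho n * S a b)%R) f)%:E)%E.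
Proof.
move=> sbm pi0 P01 f0 f1; have [_ /le_trans] := is_sbm_event Q sbm; apply.
rewrite lee_fin big_mkcond; apply: ler_sum => c _.
have p0 := sbm_prob_ge0 c pi0 P01.
case: ifPn => [/set_mem /f1 fc|_]; last exact: mulr_ge0.
by rewrite ler_peMl.
Qed.

(** * From deviations of [hatP] to deviations of edge counts *)

(** The case [a = b] rests on [y * (y - 1) >= y ^ 2 / 2] for [y = alpha * n >= 2]. *)
Lemma n_pair_ge (R : realType) (k n : nat) (e : labeling k n) (alpha : R)
  (a b : 'I_k) : in_F alpha e -> 2 <= alpha * n%:R ->
  alpha ^+ 2 * n%:R ^+ 2 / 2 <= n_pair R e a b.
Proof.
move=> Fe; have := Fe a; have := Fe b; rewrite /n_pair -exprMn.
move: (alpha * n%:R) => y; case: ifP => _; nra.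
Qed.

Lemma hatP_deviation (R : realType) (k n : nat) (A : adjmat n)
  (e : labeling k n) (alpha tau m : R) (a b : 'I_k) :
  in_F alpha e -> 2 <= alpha * n%:R -> 0 <= tau ->
  tau <= `|hatP R A e a b - m / n_pair R e a b| ->
  tau * (alpha ^+ 2 * n%:R ^+ 2 / 2) <= `|o_pair R A e a b - m|.
Proof.
move=> Fe an tau0; have := n_pair_ge a b Fe an; set N := n_pair _ _ _ _ => N2.
have N0 : 0 < N by apply: lt_le_trans N2; rewrite -exprMn; nra.
rewrite /hatP -mulrBl normrM normfV (gtr0_norm N0) ler_pdivlMr //.
by apply: le_trans; apply: ler_wpM2l.
Qed.

Lemma pos_lower_bound (R : realType) (k : nat) (F : 'I_k -> R) :
  (forall a, 0 < F a) -> exists2 c, 0 < c & forall a, c <= F a.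
Proof.
move=> F0; exists (\big[Num.min/1]_a F a); first exact: lt_bigmin.
by move=> a; exact: bigmin_le.
Qed.

Lemma pos_upper_bound (R : realType) (k : nat) (S : 'I_k -> 'I_k -> R) :
  (forall a b, 0 < S a b) -> exists2 M, 0 < M & forall a b, S a b <= M.
Proof.
move=> S0; exists (1 + \sum_a \sum_b S a b).
  by rewrite ltr_pwDl // sumr_ge0 // => a _; rewrite sumr_ge0 // => b _; exact: ltW.
move=> a b; rewrite ler_wpDl // (bigD1 a) //= (bigD1 b) //= -addrA lerDl.
rewrite addr_ge0 ?sumr_ge0 // => [c _|c _]; first exact: ltW.
by rewrite sumr_ge0 // => ? _; exact: ltW.
Qed.

(** * Probability bounds at a fixed [n] *)

(** Union bound: either some class of the true labels has fewer than [c * n] members, or all are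
    large and some pair of classes has a deviating edge count. *)
Lemma sbm_true_labels_bound (R : realType) (d : measure_display)
  (T : measurableType d) (Pr : probability T R) (k : nat) (pi : 'I_k -> R)
  (rho : nat -> R) (S : 'I_k -> 'I_k -> R) (X : forall n, T -> config k n)
  (n : nat) (c M l tau : R) :
  (forall a, 0 <= pi a) -> \sum_(a : 'I_k) pi a = 1 ->
  (forall a b, S a b = S b a) -> (forall a b, 0 <= rho n * S a b <= 1) ->
  is_sbm Pr pi rho S X -> (forall a b, rho n * S a b <= rho n * M) ->
  (forall a, c <= pi a / 4) -> 2 <= c * n%:R -> 0 <= l <= 4^-1 -> 0 <= tau ->
  (Pr (X n @^-1` [set x | ~ forall a b : 'I_k,
        (`|hatP R x.2 x.1 a b - rho n * S a b| < tau)%R]) <=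
   (k%:R * expR (- (c * n%:R)) +
    2 * k%:R ^+ 2 * expR (8 * l ^+ 2 * (rho n * M) * n%:R ^+ 2
                          - l * (tau * (c ^+ 2 * n%:R ^+ 2 / 2))))%:E)%E.
Proof.
move=> pi0 pi1 symS P01 sbm SM cpi cn l01 tau0.
set P := fun a b => rho n * S a b; set t := tau * _.
have symP a b : P a b = P b a by rewrite /P symS.
pose f (x : config k n) : R :=
  \sum_a expR (c * n%:R - (n_lab x.1 a)%:R) +
  \sum_a \sum_b chernoff_weight l t (o_pair R x.2 x.1 a b - mean_pair P x.1 x.1 a b).
have l0 : 0 <= l by case/andP: l01.
have f1_0 x : 0 <= \sum_a expR (c * n%:R - (n_lab (x : config k n).1 a)%:R) :> R.
  by apply: sumr_ge0 => a _; exact: expR_ge0.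
have f2_0 x : 0 <= \sum_a \sum_b
    chernoff_weight l t (o_pair R (x : config k n).2 x.1 a b - mean_pair P x.1 x.1 a b).
  by apply: sumr_ge0 => a _; apply: sumr_ge0 => b _; exact: chernoff_weight_ge0.
apply: le_trans (is_sbm_event_le (f := f) sbm pi0 P01 _ _) _.
- by move=> x; exact: addr_ge0.
- move=> x bad; case: (pselect (in_F c x.1)) => [Fx|].
    have [a [b dev]] : exists a b, tau <= `|hatP R x.2 x.1 a b - P a b|.
      apply: contra_notP bad => /forallNP H a b.
      by rewrite ltNge; apply/negP => le_tau; apply: (H a); exists b.
    rewrite /f ler_wpDl // (bigD1 a) //= (bigD1 b) //= -addrA ler_wpDr //.
      rewrite addr_ge0 ?sumr_ge0 // => [i _|i _]; first exact: chernoff_weight_ge0.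
      by apply: sumr_ge0 => j _; exact: chernoff_weight_ge0.
    apply: chernoff_weight_ge1 => //; apply: hatP_deviation => //.
    rewrite mean_pair_diag // mulfK // gt_eqF //.
    by apply: lt_le_trans (n_pair_ge a b Fx cn); rewrite -exprMn; nra.
  (* Some class is too small here, and its exponential alone is at least 1. *)
  move=> /existsNP[a /negP]; rewrite -ltNge => na.
  rewrite /f ler_wpDr // (bigD1 a) //= ler_wpDr //.
    by apply: sumr_ge0 => i _; exact: expR_ge0.
  by rewrite -[leLHS]expR0 ler_expR subr_ge0 ltW.
rewrite lee_fin /f EsbmD !Esbm_sum; apply: lerD.
  rewrite [leRHS](_ : _ = \sum_(a : 'I_k) expR (- (c * n%:R))).
    by apply: ler_sum => a _; exact: Esbm_class_size.
  by rewrite sumr_const card_ord mulr_natl.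
rewrite [leRHS](_ : _ = \sum_(a : 'I_k) \sum_(b : 'I_k)
    2 * expR (8 * l ^+ 2 * (rho n * M) * n%:R ^+ 2 - l * t)).
  apply: ler_sum => a _; rewrite Esbm_sum; apply: ler_sum => b _.
  exact: (Esbm_chernoff t id a b pi0 pi1 P01 SM l01).
rewrite !sumr_const !card_ord -mulrnA -[RHS]mulr_natr natrM; ring.
Qed.

(** Union bound over the [k ^ 2 * k ^ n] triples of two classes and a labeling; for fixed [e]
    Chernoff applies whatever the true labels, and [P_R_mean] identifies the centre. *)
Lemma sbm_uniform_bound (R : realType) (d : measure_display)
  (T : measurableType d) (Pr : probability T R) (k : nat) (pi : 'I_k -> R)
  (rho : nat -> R) (S : 'I_k -> 'I_k -> R) (X : forall n, T -> config k n)
  (n : nat) (alpha M l tau : R) :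
  (forall a, 0 <= pi a) -> \sum_(a : 'I_k) pi a = 1 ->
  (forall a b, S a b = S b a) -> (forall a b, 0 <= rho n * S a b <= 1) ->
  is_sbm Pr pi rho S X -> (forall a b, rho n * S a b <= rho n * M) ->
  2 <= alpha * n%:R -> 0 <= l <= 4^-1 -> 0 <= tau ->
  (Pr (X n @^-1` [set x | ~ forall (a b : 'I_k) (e : labeling k n),
        in_F alpha e ->
        (`|hatP R x.2 e a b - P_R n (fun i j => rho n * S i j)
             (confusion R e x.1) a b| < tau)%R]) <=
   (2 * k%:R ^+ 2 * k%:R ^+ n *
    expR (8 * l ^+ 2 * (rho n * M) * n%:R ^+ 2
          - l * (tau * (alpha ^+ 2 * n%:R ^+ 2 / 2))))%:E)%E.
Proof.
move=> pi0 pi1 symS P01 sbm SM an l01 tau0.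
set P := fun a b => rho n * S a b; set t := tau * _.
have symP a b : P a b = P b a by rewrite /P symS.
pose g (i : 'I_k * 'I_k * labeling k n) (x : config k n) : R :=
  chernoff_weight l t (o_pair R x.2 i.2 i.1.1 i.1.2 - mean_pair P i.2 x.1 i.1.1 i.1.2).
have g0 i x : 0 <= g i x by exact: chernoff_weight_ge0.
have l0 : 0 <= l by case/andP: l01.
have n0 : (0 < n)%N.
  by rewrite lt0n; apply/negP => /eqP nz; move: an; rewrite nz mulr0; lra.
apply: le_trans (is_sbm_event_le (f := fun x => \sum_i g i x) sbm pi0 P01 _ _) _.
- by move=> x; exact: sumr_ge0.
- move=> x bad.
  have [a [b [e [Fe dev]]]] : exists a b e, in_F alpha e /\
      tau <= `|hatP R x.2 e a b - P_R n P (confusion R e x.1) a b|.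
    apply: contra_notP bad => /forallNP H a b e Fe.
    by rewrite ltNge; apply/negP => le_tau; apply: (H a); exists b, e.
  rewrite (bigD1 (a, b, e)) //= ler_wpDr ?sumr_ge0 //.
  apply: chernoff_weight_ge1 => //; apply: hatP_deviation => //.
  by rewrite -P_R_mean.
rewrite lee_fin Esbm_sum.
rewrite [leRHS](_ : _ = \sum_(i : 'I_k * 'I_k * labeling k n)
    2 * expR (8 * l ^+ 2 * (rho n * M) * n%:R ^+ 2 - l * t)).
  apply: ler_sum => -[[a b] e] _.
  exact: (Esbm_chernoff t (fun=> e) a b pi0 pi1 P01 SM l01).
rewrite sumr_const !card_prod card_ffun !card_ord -[RHS]mulr_natr !natrM natrX; ring.
Qed.

(** * Borel-Cantelli and limits *)

(** The first Borel-Cantelli lemma for the complements of the [G n], whose probabilities are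
    summable. *)
Lemma probability_eventually (R : realType) (d : measure_display)
  (T : measurableType d) (Pr : probability T R) (G : nat -> set T) (C : R)
  (N0 : nat) : (forall n, measurable (G n)) -> 0 <= C ->
  (forall n, (N0 <= n)%N -> (Pr (~` G n) <= (C * expR (- n%:R))%:E)%E) ->
  Pr [set w | exists N : nat, forall n : nat, (N <= n)%N -> G n w] = 1%E.
Proof.
(* The shift by [N0] makes the bound valid at every index. *)
move=> mG C0 bnd; pose B n := ~` G (n + N0)%N.
have mB n : measurable (B n) by exact: measurableC.
have -> : [set w | exists N : nat, forall n, (N <= n)%N -> G n w] =
    ~` lim_sup_set B.
  apply/seteqP; split => w.
    move=> [N HN] /(_ N I) [j /= Nj]; apply; apply: HN.
    exact: (leq_trans Nj (leq_addr _ _)).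
  move=> nlim; apply: contrapT => nG; apply: nlim => n _; apply: contrapT => nB.
  apply: nG; exists (n + N0)%N => m nm; apply: contrapT => nGm.
  have N0m : (N0 <= m)%N by exact: leq_trans (leq_addl n N0) nm.
  apply: nB; exists (m - N0)%N => /=; first by rewrite leq_subRL // addnC.
  by rewrite /B subnK.
rewrite probability_setC; last first.
  by apply: bigcapT_measurable => n; exact: bigcup_measurable.
rewrite lim_sup_set_cvg0 ?sube0 //.
(* As [2 <= expR 1], the terms are at most [C / 2 ^ n], a geometric series of total [2 * C]. *)
apply: (@le_lt_trans _ _ (2 * C)%:E); last exact: ltry.
apply: le_trans (epsilon_trick0 xpredT (mulr_ge0 (ler0n _ 2) C0)).
apply: lee_nneseries => [//|n _].
apply: le_trans (bnd _ (leq_addl _ _)) _; rewrite lee_fin.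
rewrite natrX exprS -mulf_div divff ?pnatr_eq0 // mul1r; apply: ler_wpM2l => //.
rewrite expRN lef_pV2 ?posrE ?expR_gt0 ?exprn_gt0 //.
apply: (@le_trans _ _ (expR 1 ^+ n)).
  by rewrite lerXn2r ?nnegrE ?expR_ge0 //; apply: le_trans (expR_ge1Dx 1); lra.
by rewrite -expRM_natl mulr1 ler_expR ler_nat leq_addr.
Unshelve. all: by [].
Qed.

Lemma sqrt_ln_cvgy (R : realType) (K delta : R) : 0 < K -> 0 < delta ->
  (fun n => K * Num.sqrt (delta * ln (n%:R : R))) @ \oo --> +oo.
Proof.
move=> K0 d0; apply/cvgryPge => A; near=> n.
rewrite mulrC -ler_pdivrMr //.
case: (lerP (A / K) 0) => [AK|AK]; first exact: le_trans AK (sqrtr_ge0 _).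
rewrite -[leLHS](ger0_norm (ltW AK)) -sqrtr_sqr ler_wsqrtr //.
rewrite -ler_pdivrMl // -ler_expR lnK; last first.
  by rewrite posrE (@lt_le_trans _ _ 1) //; near: n; exact: nbhs_infty_ger.
near: n; exact: nbhs_infty_ger.
Unshelve. all: by end_near. Qed.

Lemma cvg_expRN (R : realType) (y : nat -> R) : y @ \oo --> +oo ->
  (fun n => expR (- y n)) @ \oo --> 0.
Proof. by move=> yoo; exact: (cvg_comp _ _ yoo (@cvgr_expR R)). Qed.

Lemma natr_cvgy (R : realType) (c : R) : 0 < c ->
  (fun n => c * n%:R) @ \oo --> +oo.
Proof.
move=> c0; apply/cvgryPge => A; near=> n.
by rewrite -ler_pdivrMl //; near: n; exact: nbhs_infty_ger.
Unshelve. all: by end_near. Qed.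

(** * Choice of the parameters and the two claims *)

Theorem theorem4 (R : realType) (k : nat) (pi : 'I_k -> R)
  (S : 'I_k -> 'I_k -> R) (rho : nat -> R)
  (d : measure_display) (T : measurableType d) (Pr : probability T R)
  (X : forall n, T -> config k n) :
  (2 <= k)%N ->
  (forall a, 0 < pi a) -> \sum_(a : 'I_k) pi a = 1 ->
  (forall a b, S a b = S b a) -> (forall a b, 0 < S a b) ->
  (forall a b, a != b -> exists c, S c a != S c b) ->
  (forall n, 0 <= rho n) -> (forall n a b, rho n * S a b <= 1) ->
  rho @ \oo --> 0 ->
  (fun n => n%:R * rho n) @ \oo --> +oo ->
  is_sbm Pr pi rho S X ->
  (forall delta : R, 0 < delta ->
     (fun n => Pr [set w | forall a b : 'I_k,
          `|hatP R (X n w).2 (X n w).1 a b - rho n * S a b|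
            < Num.sqrt (delta * rho n * ln (n%:R : R)) / n%:R])
       @ \oo --> 1%E)
  /\
  (forall alpha delta : R, 0 < alpha -> 0 < delta -> delta < smin S / 2 ->
     (\forall n \near \oo,
        4 * smax S / (alpha ^+ 2 * delta ^+ 2) < n%:R * rho n) ->
     Pr [set w | exists N : nat, forall n : nat, (N <= n)%N ->
          forall (a b : 'I_k) (e : labeling k n), in_F alpha e ->
            `|hatP R (X n w).2 e a b
              - P_R n (fun i j => rho n * S i j) (confusion R e (X n w).1) a b|
              < delta * rho n] = 1%E).
Proof.
move=> _ pi0 pi1 symS S0 _ rho0 rhoS1 _ nrho sbm.
have [M M0 SM] := pos_upper_bound S0.
have pi0' a : 0 <= pi a by exact: ltW.
have P01 n a b : 0 <= rho n * S a b <= 1 by rewrite rhoS1 mulr_ge0 // ltW.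
have PM n a b : rho n * S a b <= rho n * M by exact: ler_wpM2l.
move/cvgryPge: nrho => nrho.
split=> [delta d0|alpha delta a0 d0 _ _].
- have [c c0 cpi] : exists2 c, 0 < c & forall a, c <= pi a / 4.
    by apply: pos_lower_bound => a; rewrite divr_gt0.
  pose G n : set (config k n) := [set x | forall a b : 'I_k,
    `|hatP R x.2 x.1 a b - rho n * S a b|
      < Num.sqrt (delta * rho n * ln (n%:R : R)) / n%:R].
  (* The fixed-[n] bound at [l = 1 / (n sqrt rho)]: the quadratic part of the exponent is the
     constant [8 * M], the linear part a multiple of [sqrt (delta ln n)]. *)
  pose u n := k%:R * expR (- (c * n%:R)) + 2 * k%:R ^+ 2 * expR (8 * M) *
    expR (- (c ^+ 2 / 2 * Num.sqrt (delta * ln (n%:R : R)))).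
  have u0 : u @ \oo --> 0.
    rewrite -[X in _ --> X](_ : k%:R * 0 + 2 * k%:R ^+ 2 * expR (8 * M) * 0 = 0);
      last by rewrite !mulr0 addr0.
    apply: cvgD; apply: cvgMr; apply: cvg_expRN; first exact: natr_cvgy.
    by apply: sqrt_ln_cvgy => //; rewrite divr_gt0 // exprn_gt0.
  have bnd : \forall n \near \oo, (Pr (X n @^-1` ~` G n) <= (u n)%:E)%E.
    near=> n.
    have n1 : 1 <= n%:R :> R by near: n; exact: nbhs_infty_ger.
    have cn : 2 <= c * n%:R.
      by rewrite -ler_pdivrMl //; near: n; exact: nbhs_infty_ger.
    (* Gives [(n * s) ^+ 2 = n * (n * rho n) >= 16], hence [l <= 1/4], and also [rho n > 0]. *)
    have nr : 16 <= n%:R * rho n by near: n; exact: nrho.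
    pose s := Num.sqrt (rho n).
    have s2 : s ^+ 2 = rho n by rewrite sqr_sqrtr.
    have s0 : 0 < s by rewrite sqrtr_gt0; nra.
    have n0 : 0 < n%:R :> R by lra.
    pose l := (n%:R * s)^-1.
    have l01 : 0 <= l <= 4^-1.
      have ns0 : 0 < n%:R * s by exact: mulr_gt0.
      apply/andP; split; first by rewrite invr_ge0 ltW.
      rewrite lef_pV2 ?posrE //.
      rewrite -(ler_pXn2r (n := 2)) ?nnegrE // ?(ltW ns0) // exprMn s2.
      nra.
    apply: (le_trans (sbm_true_labels_bound pi0' pi1 symS (P01 n) sbm (PM n)
      cpi cn l01 _)); first by rewrite divr_ge0 ?sqrtr_ge0 // ltW.
    rewrite lee_fin /u lerD2l -[leRHS]mulrA -expRD.
    rewrite -(mulrA delta) (mulrCA delta) sqrtrM //.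
    rewrite -/s -s2; set q := Num.sqrt (delta * _).
    rewrite (_ : 8 * l ^+ 2 * (s ^+ 2 * M) * n%:R ^+ 2 -
        l * (s * q / n%:R * (c ^+ 2 * n%:R ^+ 2 / 2)) =
        8 * M + - (c ^+ 2 / 2 * q)) //.
    by rewrite /l; field; rewrite !gt_eqF.
  have mG n : measurable (X n @^-1` G n) by have [] := is_sbm_event (G n) sbm.
  have PG n : Pr (X n @^-1` G n) = (1 - Pr (X n @^-1` ~` G n))%E.
    by rewrite -preimage_setC -probability_setC ?setCK //; exact: measurableC.
  apply: (@squeeze_cvge _ _ _ _ (fun n => (1 - u n)%:E) _ (cst 1%E)).
  + near=> n; apply/andP; split; last exact: (probability_le1 Pr (mG n)).
    rewrite [leRHS]PG EFinB leeB //; near: n; exact: bnd.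
  + apply: cvg_EFin; first exact: nearW.
    rewrite -[X in _ --> X](subr0 1); apply: cvgB => //; exact: cvg_cst.
  + exact: cvg_cst.
- pose G n : set (config k n) := [set x | forall (a b : 'I_k) (e : labeling k n),
    in_F alpha e -> `|hatP R x.2 e a b
      - P_R n (fun i j => rho n * S i j) (confusion R e x.1) a b| < delta * rho n].
  (* With this [l] the quadratic term [8 * l^2 * M * rho * n^2] is at most half the linear term
     [l * delta * rho * alpha^2 * n^2 / 2]; the other half is [kappa * rho * n^2]. *)
  pose l := Num.min 4^-1 (delta * alpha ^+ 2 / (32 * M)).
  have l0 : 0 < l.
    by rewrite lt_min invr_gt0 ltr0n /= divr_gt0 ?mulr_gt0 ?exprn_gt0.
  have l01 : 0 <= l <= 4^-1 by rewrite ltW //= ge_min lexx.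
  have lM : 32 * M * l <= delta * alpha ^+ 2.
    by rewrite mulrC -ler_pdivlMr ?mulr_gt0 // ge_min lexx orbT.
  pose kappa := l * delta * alpha ^+ 2 / 4.
  have kappa0 : 0 < kappa by rewrite divr_gt0 ?mulr_gt0 ?exprn_gt0.
  have [N0 _ HN0] : \forall n \near \oo,
      (Pr (X n @^-1` ~` G n) <= (2 * k%:R ^+ 2 * expR (- n%:R))%:E)%E.
    near=> n.
    have an : 2 <= alpha * n%:R.
      by rewrite -ler_pdivrMl //; near: n; exact: nbhs_infty_ger.
    (* Then [kappa * rho * n^2 >= (k + 1) * n]: by [k <= expR k] the part [k * n] absorbs the
       [k ^ n] labelings, and [expR (- n)] remains. *)
    have nr : kappa^-1 * (k%:R + 1) <= n%:R * rho n by near: n; exact: nrho.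
    have {}nr : k%:R + 1 <= kappa * (n%:R * rho n) by rewrite -ler_pdivrMl.
    apply: (le_trans (sbm_uniform_bound pi0' pi1 symS (P01 n) sbm (PM n)
      an l01 (mulr_ge0 (ltW d0) (rho0 n)))).
    rewrite lee_fin -mulrA; apply: ler_wpM2l; first by rewrite mulr_ge0 ?sqr_ge0.
    have kn : k%:R ^+ n <= expR (n%:R * k%:R) :> R.
      rewrite expRM_natl lerXn2r ?nnegrE ?expR_ge0 //.
      by apply: le_trans (expR_ge1Dx _); rewrite lerDr.
    apply: (le_trans (ler_wpM2r (expR_ge0 _) kn)).
    rewrite -expRD ler_expR.
    have n0 : 0 <= n%:R :> R by [].
    have := ler_wpM2l n0 nr; rewrite /kappa => H.
    have : 0 <= l * rho n * n%:R ^+ 2 * (delta * alpha ^+ 2 - 32 * M * l).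
      by rewrite mulr_ge0 ?subr_ge0 // mulr_ge0 ?sqr_ge0 // mulr_ge0 // ltW.
    nra.
  apply: (@probability_eventually _ _ _ _ (fun n => X n @^-1` G n) (2 * k%:R ^+ 2) N0).
  + by move=> n; have [] := is_sbm_event (G n) sbm.
  + by rewrite mulr_ge0 ?sqr_ge0.
  + exact: HN0.
Unshelve. all: by end_near. Qed.
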